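(* Every path-connected pre-$\Delta$-group is transfinitely $\pi_1$-commutative at all of its points.
   Context: A pre-$\Delta$-monoid is a space $M$ with an associative operation $\ast$ with identity $e$ such that for any continuous paths $\alpha,\beta:[0,1]\to M$, the pointwise product $t\mapsto\alpha(t)\ast\beta(t)$ is continuous; a pre-$\Delta$-group is a pre-$\Delta$-monoid whose underlying monoid is a group (no continuity of inversion is assumed). Let $\mathbb{H}=\bigcup_nC_n$ be the Hawaiian earring ($C_n\subset\mathbb{R}^2$ the circle of radius $1/n$ centered at $(1/n,0)$, basepoint $b_0=(0,0)$), $\ell_n$ the counterclockwise loop on $C_n$. A sequence of loops $\alpha_n\in\Omega(X,x)$ is a null-sequence if every neighborhood of $x$ contains all but finitely many $\mathrm{Im}(\alpha_n)$; then there is a unique map $f:(\mathbb{H},b_0)\to(X,x)$ with $f\circ\ell_n=\alpha_n$. With $\mathcal{C}\subseteq[0,1]$ the middle-thirds Cantor set and $[0,1]\setminus\mathcal{C}=\bigcup_{n\ge1}\bigcup_{k=1}^{2^{n-1}}I_n^k$ (open intervals of length $3^{-n}$, left to right for fixed $n$), $\ell_\tau$ is the loop with $\ell_\tau(\mathcal{C})=b_0$ equal to $\ell_{2^{n-1}+k-1}$ on $\overline{I_n^k}$, and $\prod_\tau\alpha_n:=f\circ\ell_\tau$. $X$ is transfinitely $\pi_1$-commutative at $x$ if $[\prod_\tau\alpha_n]=[\prod_\tau\alpha_{\phi(n)}]$ for every null-sequence and every bijection $\phi:\mathbb{N}\to\mathbb{N}$. *)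

(* Defs.v *)
From Stdlib Require Import Reals Lra Lia Classical ClassicalEpsilon.
Open Scope R_scope.

Record TopSpace := {
  pt :> Type;
  is_open : (pt -> Prop) -> Prop;
  open_full : is_open (fun _ => True);
  open_inter : forall U V, is_open U -> is_open V -> is_open (fun x => U x /\ V x);
  open_union : forall F : (pt -> Prop) -> Prop,
      (forall U, F U -> is_open U) -> is_open (fun x => exists U, F U /\ U x)
}.

Definition cont01 (X : TopSpace) (f : R -> X) : Prop :=
  forall t, 0 <= t <= 1 -> forall U, is_open X U -> U (f t) ->
  exists d, d > 0 /\ forall s, 0 <= s <= 1 -> Rabs (s - t) < d -> U (f s).

Definition cont01sq (X : TopSpace) (H : R -> R -> X) : Prop :=
  forall s t, 0 <= s <= 1 -> 0 <= t <= 1 -> forall U, is_open X U -> U (H s t) ->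
  exists d, d > 0 /\ forall s' t', 0 <= s' <= 1 -> 0 <= t' <= 1 ->
     Rabs (s' - s) < d -> Rabs (t' - t) < d -> U (H s' t').

Definition is_path (X : TopSpace) (a : R -> X) : Prop := cont01 X a.

Definition path_connected (X : TopSpace) : Prop :=
  forall x y : X, exists a : R -> X, is_path X a /\ a 0 = x /\ a 1 = y.

Definition is_loop (X : TopSpace) (x : X) (a : R -> X) : Prop :=
  cont01 X a /\ a 0 = x /\ a 1 = x.

Definition loop_homotopic (X : TopSpace) (x : X) (a b : R -> X) : Prop :=
  exists H : R -> R -> X, cont01sq X H /\
    (forall s, 0 <= s <= 1 -> H s 0 = a s) /\
    (forall s, 0 <= s <= 1 -> H s 1 = b s) /\
    (forall u, 0 <= u <= 1 -> H 0 u = x /\ H 1 u = x).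

Definition pre_delta_monoid (X : TopSpace) (op : X -> X -> X) (e : X) : Prop :=
  (forall a b c, op a (op b c) = op (op a b) c) /\
  (forall a, op e a = a /\ op a e = a) /\
  (forall al be : R -> X, is_path X al -> is_path X be ->
      is_path X (fun t => op (al t) (be t))).

Definition pre_delta_group (X : TopSpace) (op : X -> X -> X) (e : X) : Prop :=
  pre_delta_monoid X op e /\ (forall a, exists b, op a b = e /\ op b a = e).

(** Null-sequences (indexed from 0: al 0, al 1, ... correspond to alpha_1, alpha_2, ...). *)
Definition null_sequence (X : TopSpace) (x : X) (al : nat -> R -> X) : Prop :=
  (forall n, is_loop X x (al n)) /\
  (forall U, is_open X U -> U x ->
     exists N, forall n, (N <= n)%nat -> forall t, 0 <= t <= 1 -> U (al n t)).

(** * Middle-thirds Cantor set complement intervals I_n^k *)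
(* tern m j : the number whose m base-3 digits are the m binary digits of j *)
Fixpoint tern (m j : nat) : nat :=
  match m with
  | O => O
  | S m' => (3 * tern m' (j / 2) + j mod 2)%nat
  end.

(* left endpoint of I_n^k (n >= 1, 1 <= k <= 2^(n-1)); length 3^(-n) *)
Definition I_left (n k : nat) : R :=
  INR (6 * tern (n - 1) (k - 1) + 1) / 3 ^ n.

Definition in_piece (t : R) (nk : nat * nat) : Prop :=
  let (n, k) := nk in
  (1 <= n)%nat /\ (1 <= k <= 2 ^ (n - 1))%nat /\
  I_left n k <= t <= I_left n k + / 3 ^ n.

(* 0-based index of the loop used on I_n^k:  (2^(n-1) + k - 1) - 1 *)
Definition piece_index (nk : nat * nat) : nat :=
  let (n, k) := nk in (2 ^ (n - 1) + k - 2)%nat.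

(** Transfinite product  prod_tau alpha_n = f o ell_tau :
    equal to the basepoint on the Cantor set and to alpha_{2^(n-1)+k-1},
    linearly reparametrized, on the closure of I_n^k. *)
Definition tau_product (X : TopSpace) (x : X) (al : nat -> R -> X) (t : R) : X :=
  match excluded_middle_informative (exists nk, in_piece t nk) with
  | left H =>
      let nk := proj1_sig (constructive_indefinite_description _ H) in
      al (piece_index nk) ((t - I_left (fst nk) (snd nk)) * 3 ^ (fst nk))
  | right _ => x
  end.

Definition bijective_nat (phi : nat -> nat) : Prop :=
  (forall a b, phi a = phi b -> a = b) /\ (forall b, exists a, phi a = b).

Definition transfinitely_pi1_commutative (X : TopSpace) (x : X) : Prop :=
  forall (al : nat -> R -> X) (phi : nat -> nat),
    null_sequence X x al -> bijective_nat phi ->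
    loop_homotopic X x (tau_product X x al) (tau_product X x (fun n => al (phi n))).

(* Main.v *)
Require Import Defs.
From Stdlib Require Import Reals Lra Lia Classical ClassicalEpsilon.

(* In a pre-Delta-group, a * x^-1 * b is a pre-Delta-monoid operation with identity x, so
   it suffices to treat the basepoint e of a pre-Delta-monoid.

   There, loops with disjoint supports can be multiplied pointwise in any order.  Starting
   from the transfinite product, the n-th loop is slid from its old interval to its new one
   during the n-th of infinitely many consecutive time intervals; the homotopy is the
   pointwise product of the loops already moved, the moving loop, and the loops still to be
   moved.  At the final time continuity reduces to this: if points y_k, z_k are joined to
   y, z by paths that shrink to y, z, then y_k * z_k accumulates at y * z, because
   all these paths can be concatenated into a single path through the y_k that ends at y. *)

(** * Choice and elementary real estimates *)

Lemma fun_choice (A : Type) (P : nat -> A -> Prop) :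
  (forall k, exists a, P k a) -> exists f, forall k, P k (f k).
Proof.
  intros H.
  exists (fun k => proj1_sig (constructive_indefinite_description _ (H k))).
  intros k. apply proj2_sig.
Qed.

(** Gives one radius for the finitely many loops that a null-sequence leaves outside a given
    neighborhood. *)
Lemma uniform_below (P : nat -> R -> Prop) (N : nat) :
  (forall m d d', 0 < d' <= d -> P m d -> P m d') ->
  (forall m, (m < N)%nat -> exists d, d > 0 /\ P m d) ->
  exists d, d > 0 /\ forall m, (m < N)%nat -> P m d.
Proof.
  intros mono. induction N as [|N IH]; intros H.
  - exists 1. split; [lra | intros; lia].
  - destruct IH as (d1 & hd1 & H1). { intros; apply H; lia. }
    destruct (H N) as (d2 & hd2 & H2); [lia|].
    assert (hm : 0 < Rmin d1 d2) by (apply Rmin_glb_lt; lra).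
    exists (Rmin d1 d2). split; [exact hm|]. intros m hmN.
    destruct (Nat.eq_dec m N) as [->|ne].
    + apply (mono N d2); auto. split; auto. apply Rmin_r.
    + apply (mono m d1); [|apply H1; lia]. split; auto. apply Rmin_l.
Qed.

Lemma le_div_iff a b c : 0 < c -> (a <= b / c <-> a * c <= b).
Proof.
  intros hc. replace b with (b / c * c) at 2 by (field; lra).
  split; intros; [apply Rmult_le_compat_r | apply Rmult_le_reg_r with c]; lra.
Qed.

Lemma div_le_iff a b c : 0 < c -> (b / c <= a <-> b <= a * c).
Proof.
  intros hc. replace b with (b / c * c) at 2 by (field; lra).
  split; intros; [apply Rmult_le_compat_r | apply Rmult_le_reg_r with c]; lra.
Qed.

Lemma div_lt_iff a b c : 0 < c -> (b / c < a <-> b < a * c).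
Proof.
  intros hc. replace b with (b / c * c) at 2 by (field; lra).
  split; intros; [apply Rmult_lt_compat_r | apply Rmult_lt_reg_r with c]; lra.
Qed.

Lemma lt_div_iff a b c : 0 < c -> (a < b / c <-> a * c < b).
Proof.
  intros hc. replace b with (b / c * c) at 2 by (field; lra).
  split; intros; [apply Rmult_lt_compat_r | apply Rmult_lt_reg_r with c]; lra.
Qed.

Lemma inv_INR_pos (k : nat) (c : R) : 0 < c -> 0 < / (INR k + c).
Proof. intros hc. apply Rinv_0_lt_compat. pose proof (pos_INR k). lra. Qed.

Lemma inv_INR_le (c c' : R) (k n : nat) :
  0 < c -> INR k + c <= INR n + c' -> / (INR n + c') <= / (INR k + c).
Proof. intros hc h. apply Rinv_le_contravar; auto. pose proof (pos_INR k). lra. Qed.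

Lemma inv_INR_lt_rev (c c' : R) (k n : nat) :
  0 < c -> 0 < c' -> / (INR n + c') < / (INR k + c) -> INR k + c < INR n + c'.
Proof.
  intros hc hc' h. destruct (Rlt_or_le (INR k + c) (INR n + c')) as [|h2]; auto.
  pose proof (pos_INR k). pose proof (pos_INR n).
  apply Rinv_le_contravar in h2; lra.
Qed.

Lemma small_inv_INR (d c : R) : 0 < d -> 0 < c -> exists k, / (INR k + c) < d.
Proof.
  intros hd hc. destruct (INR_unbounded (/ d)) as [k hk]. exists k.
  pose proof (Rinv_0_lt_compat _ hd).
  rewrite <- (Rinv_inv d). apply Rinv_lt_contravar; [|lra].
  apply Rmult_lt_0_compat; lra.
Qed.

(** * Ramps and cells *)

(** Clamping sends everything left of the interval to 0 and everything right of it to 1. A loop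
    composed with [ramp] is therefore constant at the basepoint outside the interval. *)
Definition ramp (l r t : R) : R := Rmax 0 (Rmin 1 ((t - l) / (r - l))).

Lemma ramp_bounds l r t : 0 <= ramp l r t <= 1.
Proof. unfold ramp, Rmax, Rmin. repeat destruct Rle_dec; lra. Qed.

Lemma ramp_left l r t : l < r -> t <= l -> ramp l r t = 0.
Proof.
  intros h ht. assert (hd : (t - l) / (r - l) <= 0).
  { unfold Rdiv. pose proof (Rinv_0_lt_compat (r - l)). nra. }
  unfold ramp, Rmax, Rmin. repeat destruct Rle_dec; lra.
Qed.

Lemma ramp_right l r t : l < r -> r <= t -> ramp l r t = 1.
Proof.
  intros h ht. assert (hd : 1 <= (t - l) / (r - l)).
  { apply le_div_iff; lra. }
  unfold ramp, Rmax, Rmin. repeat destruct Rle_dec; lra.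
Qed.

Lemma ramp_mid l r t : l < r -> l <= t <= r -> ramp l r t = (t - l) / (r - l).
Proof.
  intros h ht.
  assert (hd : (t - l) / (r - l) <= 1) by (apply div_le_iff; lra).
  assert (hd' : 0 <= (t - l) / (r - l)) by (apply le_div_iff; lra).
  unfold ramp, Rmax, Rmin. repeat destruct Rle_dec; lra.
Qed.

Lemma ramp_inner l r t : l < r -> 0 < ramp l r t < 1 -> l < t < r.
Proof.
  intros h hr. split.
  - destruct (Rlt_or_le l t); auto. rewrite ramp_left in hr; lra.
  - destruct (Rlt_or_le t r); auto. rewrite ramp_right in hr; lra.
Qed.

Definition cont_real (f : R -> R) : Prop :=
  forall t, 0 <= t <= 1 -> forall eps, eps > 0 ->
  exists d, d > 0 /\ forall s, 0 <= s <= 1 -> Rabs (s - t) < d -> Rabs (f s - f t) < eps.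

Lemma ramp_cont l r : l < r -> cont_real (ramp l r).
Proof.
  intros h t _ eps heps. exists (eps * (r - l)). split; [nra|].
  intros s _ hs.
  apply Rle_lt_trans with (Rabs ((s - t) / (r - l))).
  - replace ((s - t) / (r - l)) with ((s - l) / (r - l) - (t - l) / (r - l)) by (field; lra).
    unfold ramp, Rmax, Rmin, Rabs. repeat destruct Rle_dec; repeat destruct Rcase_abs; lra.
  - unfold Rdiv. rewrite Rabs_mult, (Rabs_right (/ (r - l))).
    + apply div_lt_iff; lra.
    + apply Rle_ge, Rlt_le, Rinv_0_lt_compat. lra.
Qed.

(* [r n] encodes the open interval on which it takes values in (0,1),
   together with a parametrization of that interval. *)
Definition cell_family (r : nat -> R -> R) : Prop :=
  (forall n, cont_real (r n)) /\ (forall n t, 0 <= r n t <= 1) /\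
  (forall n, r n 0 = 0 /\ r n 1 = 1) /\
  (forall t m n, 0 < r m t < 1 -> 0 < r n t < 1 -> m = n).

Lemma ramp_cells (l r : nat -> R) :
  (forall n, 0 <= l n < r n /\ r n <= 1) ->
  (forall m n, m <> n -> r m <= l n \/ r n <= l m) ->
  cell_family (fun n => ramp (l n) (r n)).
Proof.
  intros h hd. split; [|split; [|split]].
  - intros n. apply ramp_cont. apply h.
  - intros. apply ramp_bounds.
  - intros n. destruct (h n). split; [apply ramp_left | apply ramp_right]; lra.
  - intros t m n hm hn.
    destruct (h n), (h m). apply ramp_inner in hm; [|lra]. apply ramp_inner in hn; [|lra].
    destruct (Nat.eq_dec m n) as [|ne]; auto. destruct (hd m n ne); lra.
Qed.

(** * Infinite concatenations of null-sequences *)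

Section Scatter.
Context (X : TopSpace) (e : X).

(** For a cell family at most one [n] qualifies at each [t], so the choice of witness does not
    affect the value. *)
Definition scatter (r : nat -> R -> R) (al : nat -> R -> X) (t : R) : X :=
  match excluded_middle_informative (exists n, 0 < r n t < 1) with
  | left H => let n := proj1_sig (constructive_indefinite_description _ H) in al n (r n t)
  | right _ => e
  end.

Lemma scatter_in r al t n : cell_family r -> 0 < r n t < 1 -> scatter r al t = al n (r n t).
Proof.
  intros (_ & _ & _ & hd) hn. unfold scatter.
  destruct excluded_middle_informative as [H|H].
  - destruct constructive_indefinite_description as [m hm]; simpl.
    rewrite (hd t m n); auto.
  - exfalso; eauto.
Qed.

Lemma scatter_out r al t : (forall n, ~ 0 < r n t < 1) -> scatter r al t = e.
Proof.
  intros h. unfold scatter. destruct excluded_middle_informative as [[n H]|H]; auto.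
  exfalso; eapply h; eauto.
Qed.

(** Off its cell the parameter is 0 or 1, and a loop takes the basepoint value at both. *)
Lemma loop_off_cell r al n t :
  cell_family r -> is_loop X e (al n) -> ~ 0 < r n t < 1 -> al n (r n t) = e.
Proof.
  intros (_ & hb & _) (_ & h0 & h1) hn. pose proof (hb n t).
  destruct (Req_dec (r n t) 0) as [->|]; auto.
  destruct (Req_dec (r n t) 1) as [->|]; auto. lra.
Qed.

Lemma scatter_ends r al : cell_family r -> scatter r al 0 = e /\ scatter r al 1 = e.
Proof.
  intros (_ & _ & he & _). split; apply scatter_out; intros n; destruct (he n); lra.
Qed.

(** Inside a cell only one loop matters. At any other point every loop has value [e]: the null
    condition controls all loops of large index, and continuity controls each of the finitely many
    others. *)
Lemma scatter_cont r al :
  cell_family r -> null_sequence X e al -> cont01 X (scatter r al).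
Proof.
  intros hr [hl hnull] t ht U hU HU. pose proof hr as (hc & hb & he & hd).
  destruct (classic (exists n, 0 < r n t < 1)) as [[n hn]|hno].
  - rewrite (scatter_in _ _ _ n) in HU by auto.
    destruct (hl n) as [hcn _].
    destruct (hcn (r n t) (hb n t) U hU HU) as (d1 & hd1 & H1).
    (* The bounds [r n t] and [1 - r n t] keep nearby points inside the same open cell. *)
    destruct (hc n t ht (Rmin d1 (Rmin (r n t) (1 - r n t)))) as (d & hdp & H).
    { repeat apply Rmin_glb_lt; lra. }
    exists d. split; auto. intros s hs hst. specialize (H s hs hst).
    apply Rmin_Rgt_l in H as [Ha H]. apply Rmin_Rgt_l in H as [Hb Hc].
    apply Rabs_def2 in Hb, Hc.
    rewrite (scatter_in _ _ _ n) by (auto; lra). apply H1; auto.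
  - rewrite scatter_out in HU by eauto.
    destruct (hnull U hU HU) as [N HN].
    destruct (uniform_below (fun m d => forall s, 0 <= s <= 1 -> Rabs (s - t) < d ->
        U (al m (r m s))) N) as (d & hdp & H).
    + intros m d d' hdd H s hs hst. apply H; auto; lra.
    + intros m _. destruct (hl m) as [hcm _].
      assert (HUm : U (al m (r m t))).
      { rewrite (loop_off_cell r al m t); eauto. }
      destruct (hcm (r m t) (hb m t) U hU HUm) as (d1 & hd1 & H1).
      destruct (hc m t ht d1 hd1) as (d & hdp & H).
      exists d. split; auto.
    + exists d. split; auto. intros s hs hst.
      destruct (classic (exists n, 0 < r n s < 1)) as [[n hn]|hno'].
      * rewrite (scatter_in _ _ _ n) by auto.
        destruct (Nat.lt_ge_cases n N) as [hlt|hge]; [apply H; auto | apply HN; auto].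
      * rewrite scatter_out by eauto. auto.
Qed.
End Scatter.

Arguments scatter {X} e r al t.

(** * Products of shrinking paths *)

(** The far ends [sg k 1] form the sequence of interest; the paths serve to connect them to the
    limit [y]. *)
Definition shrinking (X : TopSpace) (y : X) (sg : nat -> R -> X) : Prop :=
  (forall k, cont01 X (sg k) /\ sg k 0 = y) /\
  (forall U, is_open X U -> U y ->
     exists N, forall n, (N <= n)%nat -> forall t, 0 <= t <= 1 -> U (sg n t)).

Lemma cont01_comp2 (X : TopSpace) F g h :
  cont01sq X F -> cont_real g -> cont_real h ->
  (forall t, 0 <= t <= 1 -> 0 <= g t <= 1) -> (forall t, 0 <= t <= 1 -> 0 <= h t <= 1) ->
  cont01 X (fun t => F (g t) (h t)).
Proof.
  intros hF hg hh bg bh t ht U hU HU.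
  destruct (hF (g t) (h t) (bg t ht) (bh t ht) U hU HU) as (d & hd & H).
  destruct (hg t ht d hd) as (d1 & hd1 & H1).
  destruct (hh t ht d hd) as (d2 & hd2 & H2).
  exists (Rmin d1 d2). split; [apply Rmin_glb_lt; lra|].
  intros s hs hst. apply Rmin_Rgt_l in hst as [Ha Hb]. apply H; auto.
Qed.

Lemma cont01sq_fst (X : TopSpace) p : cont01 X p -> cont01sq X (fun s _ => p s).
Proof.
  intros hp s t hs ht U hU HU. destruct (hp s hs U hU HU) as (d & hd & H).
  exists d. split; auto.
Qed.

Lemma cont01_comp (X : TopSpace) p h :
  cont01 X p -> cont_real h -> (forall t, 0 <= t <= 1 -> 0 <= h t <= 1) ->
  cont01 X (fun t => p (h t)).
Proof.
  intros hp hh bh.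
  exact (cont01_comp2 X (fun s _ => p s) h h (cont01sq_fst X p hp) hh hh bh bh).
Qed.

Lemma cont_real_lipschitz (f : R -> R) (C : R) :
  0 < C -> (forall s t, 0 <= s <= 1 -> 0 <= t <= 1 -> Rabs (f s - f t) <= C * Rabs (s - t)) ->
  cont_real f.
Proof.
  intros hC H t ht eps he. exists (eps / C). split; [apply Rdiv_lt_0_compat; lra|].
  intros s hs hst. apply Rle_lt_trans with (1 := H s t hs ht).
  apply lt_div_iff in hst; lra.
Qed.

Lemma segment_bounds a b w :
  0 <= a <= 1 -> 0 <= b <= 1 -> 0 <= w <= 1 -> 0 <= a + w * (b - a) <= 1.
Proof. intros; nra. Qed.

Lemma segment_cont a b : 0 <= a <= 1 -> 0 <= b <= 1 -> cont_real (fun w => a + w * (b - a)).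
Proof.
  intros ha hb. apply cont_real_lipschitz with 1; [lra|]. intros s t _ _.
  replace (a + s * (b - a) - (a + t * (b - a))) with ((b - a) * (s - t)) by ring.
  rewrite Rabs_mult. apply Rmult_le_compat_r; [apply Rabs_pos|].
  apply Rabs_le; lra.
Qed.

Lemma tent_cont : cont_real (fun w => 1 - Rabs (2 * w - 1)).
Proof.
  apply cont_real_lipschitz with 2; [lra|]. intros s t _ _.
  unfold Rabs. repeat destruct Rcase_abs; lra.
Qed.

Lemma tent_bounds w : 0 <= w <= 1 -> 0 <= 1 - Rabs (2 * w - 1) <= 1.
Proof. unfold Rabs. destruct Rcase_abs; lra. Qed.

(** The midpoint of the [k]-th harmonic cell, where the tent function reaches its peak 1 and the
    back-and-forth path is at the far end of [sg k]. *)
Definition probe (k : nat) : R := (/ (INR k + 2) + / (INR k + 1)) / 2.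

Lemma probe_bounds k : 0 < probe k < / (INR k + 1).
Proof.
  unfold probe. pose proof (inv_INR_pos k 2 ltac:(lra)). pose proof (pos_INR k).
  assert (/ (INR k + 2) < / (INR k + 1)) by (apply Rinv_lt_contravar; nra). lra.
Qed.

Lemma harmonic_cells : cell_family (fun k => ramp (/ (INR k + 2)) (/ (INR k + 1))).
Proof.
  apply (ramp_cells (fun k => / (INR k + 2)) (fun k => / (INR k + 1))).
  - intros k. pose proof (inv_INR_pos k 2 ltac:(lra)). pose proof (pos_INR k).
    assert (/ (INR k + 2) < / (INR k + 1)) by (apply Rinv_lt_contravar; nra).
    assert (/ (INR k + 1) <= / 1) by (apply Rinv_le_contravar; lra).
    rewrite Rinv_1 in *. lra.
  - intros m n hmn. assert (m < n \/ n < m)%nat as [h|h] by lia;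
      [right|left]; apply inv_INR_le; try lra;
      apply le_INR in h; rewrite S_INR in h; lra.
Qed.

(* Traverse every [sg k] forth and back on a cell shrinking to [0]. *)
Lemma path_through (X : TopSpace) y sg :
  shrinking X y sg -> exists p, cont01 X p /\ p 0 = y /\ forall k, p (probe k) = sg k 1.
Proof.
  intros [hs hnull].
  set (al := fun k w => sg k (1 - Rabs (2 * w - 1))).
  exists (scatter y (fun k => ramp (/ (INR k + 2)) (/ (INR k + 1))) al).
  assert (hal : null_sequence X y al).
  { split.
    - intros k. destruct (hs k) as [hc h0]. unfold al. split; [|split].
      + apply (cont01_comp X (sg k)); auto using tent_cont, tent_bounds.
      + rewrite <- h0. f_equal. unfold Rabs; destruct Rcase_abs; lra.
      + rewrite <- h0. f_equal. unfold Rabs; destruct Rcase_abs; lra.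
    - intros U hU HU. destruct (hnull U hU HU) as [N HN]. exists N.
      intros n hn t ht. apply HN; auto. apply tent_bounds; auto. }
  pose proof harmonic_cells as hr.
  split; [|split].
  - apply scatter_cont; auto.
  - apply scatter_ends; auto.
  - intros k. pose proof (probe_bounds k) as hp.
    assert (hlt : / (INR k + 2) < / (INR k + 1)).
    { pose proof (pos_INR k). apply Rinv_lt_contravar; nra. }
    assert (hh : ramp (/ (INR k + 2)) (/ (INR k + 1)) (probe k) = / 2).
    { rewrite ramp_mid; auto; unfold probe; [|lra]. field.
      pose proof (pos_INR k). repeat split; lra. }
    rewrite (scatter_in X y _ al _ k); auto; rewrite hh; [|lra].
    unfold al. f_equal. unfold Rabs; destruct Rcase_abs; lra.
Qed.

(** The square is convex, so straight segments from the limit point to the approximating points can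
    be pushed forward along [F]. *)
Lemma shrinking_sq (X : TopSpace) F s t sk tk :
  cont01sq X F -> 0 <= s <= 1 -> 0 <= t <= 1 ->
  (forall k, 0 <= sk k <= 1 /\ 0 <= tk k <= 1 /\
     Rabs (sk k - s) < / (INR k + 1) /\ Rabs (tk k - t) < / (INR k + 1)) ->
  shrinking X (F s t) (fun k w => F (s + w * (sk k - s)) (t + w * (tk k - t))).
Proof.
  intros hF hs ht H. split.
  - intros k. destruct (H k) as (h1 & h2 & _). split.
    + apply (cont01_comp2 X F); auto using segment_cont, segment_bounds.
    + f_equal; ring.
  - intros U hU HU. destruct (hF s t hs ht U hU HU) as (d & hd & Hd).
    destruct (small_inv_INR d 1) as [N HN]; try lra.
    exists N. intros n hn w hw. destruct (H n) as (h1 & h2 & h3 & h4).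
    assert (hle : / (INR n + 1) <= / (INR N + 1)).
    { apply inv_INR_le; try lra. apply le_INR in hn. lra. }
    assert (hsmall : forall a b, Rabs (b - a) < / (INR n + 1) ->
              Rabs (a + w * (b - a) - a) < d).
    { intros a b hab. replace (a + w * (b - a) - a) with (w * (b - a)) by ring.
      rewrite Rabs_mult, (Rabs_right w) by lra. pose proof (Rabs_pos (b - a)). nra. }
    apply Hd; auto using segment_bounds.
Qed.

Lemma shrinking_path (X : TopSpace) p v vk :
  cont01 X p -> 0 <= v <= 1 ->
  (forall k, 0 <= vk k <= 1 /\ Rabs (vk k - v) < / (INR k + 1)) ->
  shrinking X (p v) (fun k w => p (v + w * (vk k - v))).
Proof.
  intros hp hv H.
  apply (shrinking_sq X (fun s _ => p s) v v vk vk); auto using cont01sq_fst.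
  intros k; destruct (H k); auto.
Qed.

(** Initial pieces of the loops are used; [k <= nk k] forces their indices to infinity. The
    redundant zeros keep the shape expected by the segment lemmas. *)
Lemma shrinking_null (X : TopSpace) e al nk wk :
  null_sequence X e al -> (forall k, (k <= nk k)%nat /\ 0 <= wk k <= 1) ->
  shrinking X e (fun k w => al (nk k) (0 + w * (wk k - 0))).
Proof.
  intros [hl hnull] H. split.
  - intros k. destruct (H k) as [_ hw]. destruct (hl (nk k)) as (hc & h0 & _). split.
    + apply (cont01_comp X (al (nk k))); auto.
      * apply segment_cont; lra.
      * intros; apply segment_bounds; lra.
    + rewrite <- h0. f_equal. ring.
  - intros U hU HU. destruct (hnull U hU HU) as [N HN]. exists N. intros n hn t ht.
    destruct (H n) as [hk hw]. apply HN; [lia|]. apply segment_bounds; lra.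
Qed.

Lemma shrinking_const (X : TopSpace) (e : X) : shrinking X e (fun _ _ => e).
Proof.
  split.
  - intros _. split; auto. intros t ht U hU HU. exists 1. split; auto. lra.
  - intros U hU HU. exists 0%nat. auto.
Qed.

(** * Continuity of products in a pre-Delta-monoid *)

Fixpoint finprod (X : Type) (op : X -> X -> X) (e : X) (x : nat -> X) (n : nat) : X :=
  match n with
  | O => e
  | S n => op (finprod X op e x n) (x n)
  end.

Section PreDeltaMonoid.
Context (X : TopSpace) (op : X -> X -> X) (e : X) (HM : pre_delta_monoid X op e).

Let opA : forall a b c, op a (op b c) = op (op a b) c. Proof. apply HM. Qed.
Let op1x : forall a, op e a = a. Proof. apply HM. Qed.
Let opx1 : forall a, op a e = a. Proof. apply HM. Qed.

(** All three concatenated paths visit their [k]-th endpoint at the same time [probe k]. Their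
    pointwise product is continuous at 0, where it equals the limit product, and the probes tend to
    0. *)
Lemma shrinking_product y z w sg tau rho U :
  shrinking X y sg -> shrinking X z tau -> shrinking X w rho ->
  is_open X U -> U (op (op y z) w) ->
  exists k, U (op (op (sg k 1) (tau k 1)) (rho k 1)).
Proof.
  intros h1 h2 h3 hU HU.
  destruct (path_through X y sg h1) as (p1 & c1 & e1 & H1).
  destruct (path_through X z tau h2) as (p2 & c2 & e2 & H2).
  destruct (path_through X w rho h3) as (p3 & c3 & e3 & H3).
  destruct HM as (_ & _ & hpath).
  pose proof (hpath _ _ (hpath _ _ c1 c2) c3) as hc. cbv beta in hc.
  destruct (hc 0 ltac:(lra) U hU) as (d & hd & H).
  { rewrite e1, e2, e3. exact HU. }
  destruct (small_inv_INR d 1) as [k hk]; try lra. exists k.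
  rewrite <- H1, <- H2, <- H3. pose proof (probe_bounds k) as hp.
  assert (/ (INR k + 1) <= / 1).
  { apply Rinv_le_contravar; [lra|]. pose proof (pos_INR k). lra. }
  rewrite Rinv_1 in *.
  apply H; [lra|]. apply Rabs_def1; lra.
Qed.

(* The unit square carries the final topology with respect to paths into it. *)
Lemma sq_product F G :
  cont01sq X F -> cont01sq X G -> cont01sq X (fun s t => op (F s t) (G s t)).
Proof.
  intros hF hG s t hs ht U hU HU. apply NNPP. intros hno.
  (* If continuity failed, each radius [1/(k+1)] would contain a bad point; the chosen points
     converge to [(s, t)]. *)
  destruct (fun_choice (R * R) (fun k st => 0 <= fst st <= 1 /\ 0 <= snd st <= 1 /\
     Rabs (fst st - s) < / (INR k + 1) /\ Rabs (snd st - t) < / (INR k + 1) /\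
     ~ U (op (F (fst st) (snd st)) (G (fst st) (snd st))))) as [f Hf].
  { intros k. apply NNPP. intros hk. apply hno. exists (/ (INR k + 1)).
    split; [apply inv_INR_pos; lra|]. intros s' t' hs' ht' h1 h2.
    apply NNPP. intros hn. apply hk. exists (s', t'). simpl. tauto. }
  assert (Hb : forall k, 0 <= fst (f k) <= 1 /\ 0 <= snd (f k) <= 1 /\
     Rabs (fst (f k) - s) < / (INR k + 1) /\ Rabs (snd (f k) - t) < / (INR k + 1)).
  { intros k. destruct (Hf k) as (? & ? & ? & ? & _). auto. }
  (* The constant [e] fills the third slot. *)
  destruct (shrinking_product _ _ _ _ _ _ U
     (shrinking_sq X F s t _ _ hF hs ht Hb) (shrinking_sq X G s t _ _ hG hs ht Hb)
     (shrinking_const X e)) as [k Hk]; auto.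
  { rewrite opx1. exact HU. }
  destruct (Hf k) as (_ & _ & _ & _ & hn). apply hn.
  rewrite opx1 in Hk.
  replace (s + 1 * (fst (f k) - s)) with (fst (f k)) in Hk by ring.
  replace (t + 1 * (snd (f k) - t)) with (snd (f k)) in Hk by ring.
  exact Hk.
Qed.

(** The three factors are the shape of the homotopy near its final time: settled loops, moving loop,
    waiting loop. Counterexamples for all radii [1/(k+1)] would give paths shrinking to [p v0], [e]
    and [e], against [shrinking_product]. *)
Lemma triple_near_path al p v0 U :
  null_sequence X e al -> cont01 X p -> 0 <= v0 <= 1 -> is_open X U -> U (p v0) ->
  exists d, d > 0 /\ forall v n1 w1 n2 w2,
    0 <= v <= 1 -> 0 <= w1 <= 1 -> 0 <= w2 <= 1 ->
    Rabs (v - v0) < d -> / (INR n1 + 2) < d -> / (INR n2 + 2) < d ->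
    U (op (op (p v) (al n1 w1)) (al n2 w2)).
Proof.
  intros hal hp hv0 hU HU. apply NNPP. intros hno.
  destruct (fun_choice (R * ((nat * R) * (nat * R))) (fun k a =>
     (0 <= fst a <= 1 /\ Rabs (fst a - v0) < / (INR k + 1)) /\
     ((k <= fst (fst (snd a)))%nat /\ 0 <= snd (fst (snd a)) <= 1) /\
     ((k <= fst (snd (snd a)))%nat /\ 0 <= snd (snd (snd a)) <= 1) /\
     ~ U (op (op (p (fst a)) (al (fst (fst (snd a))) (snd (fst (snd a)))))
             (al (fst (snd (snd a))) (snd (snd (snd a))))))) as [f Hf].
  { intros k. apply NNPP. intros hk. apply hno. exists (/ (INR k + 1)).
    split; [apply inv_INR_pos; lra|]. intros v n1 w1 n2 w2 hv hw1 hw2 h h1 h2.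
    apply NNPP. intros hn. apply hk. exists (v, ((n1, w1), (n2, w2))). simpl.
    apply inv_INR_lt_rev in h1, h2; try lra.
    assert (k < S n1)%nat by (apply INR_lt; rewrite S_INR; lra).
    assert (k < S n2)%nat by (apply INR_lt; rewrite S_INR; lra).
    repeat split; auto; try lra; lia. }
  destruct (shrinking_product _ _ _ _ _ _ U
     (shrinking_path X p v0 _ hp hv0 (fun k => proj1 (Hf k)))
     (shrinking_null X e al _ _ hal (fun k => proj1 (proj2 (Hf k))))
     (shrinking_null X e al _ _ hal (fun k => proj1 (proj2 (proj2 (Hf k))))))
    as [k Hk]; auto.
  { rewrite !opx1. exact HU. }
  apply (proj2 (proj2 (proj2 (Hf k)))).
  assert (hseg : forall a b, a + 1 * (b - a) = b) by (intros; ring).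
  rewrite !hseg in Hk. exact Hk.
Qed.

(** Packing all loops into one path over the harmonic cells turns a large index [n0] into a time
    close to 0, which reduces the claim to [triple_near_path] at time 0. *)
Lemma triple_near_tail al U :
  null_sequence X e al -> is_open X U -> U e ->
  exists d, d > 0 /\ forall n0 w0 n1 w1 n2 w2,
    0 <= w0 <= 1 -> 0 <= w1 <= 1 -> 0 <= w2 <= 1 ->
    / (INR n0 + 2) < d -> / (INR n1 + 2) < d -> / (INR n2 + 2) < d ->
    U (op (op (al n0 w0) (al n1 w1)) (al n2 w2)).
Proof.
  intros hal hU HU.
  set (hc := fun k => ramp (/ (INR k + 2)) (/ (INR k + 1))).
  assert (hq : cont01 X (scatter e hc al)).
  { apply scatter_cont; auto. exact harmonic_cells. }
  destruct (scatter_ends X e hc al harmonic_cells) as [q0 _].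
  destruct (triple_near_path al _ 0 U hal hq) as (d & hd & H); auto; [lra|rewrite q0; auto|].
  (* The cell of [n0] ends at [1/(n0+1)], which is at most [2/(n0+2)] and hence below [d]. *)
  exists (d / 2). split; [lra|]. intros n0 w0 n1 w1 n2 w2 hw0 hw1 hw2 h0 h1 h2.
  assert (hex : exists b, 0 <= b <= 1 /\ Rabs (b - 0) < d /\ scatter e hc al b = al n0 w0).
  { destruct hal as [hl _]. destruct (hl n0) as (_ & l0 & l1).
    pose proof (pos_INR n0) as hp. pose proof (inv_INR_pos n0 2 ltac:(lra)) as hp2.
    destruct (classic (0 < w0 < 1)) as [hw|hw].
    - set (l := / (INR n0 + 2)) in *. set (r := / (INR n0 + 1)).
      assert (hlr : l < r) by (apply Rinv_lt_contravar; nra).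
      assert (hr1 : r <= 1).
      { unfold r. rewrite <- Rinv_1. apply Rinv_le_contravar; lra. }
      assert (hr2 : r <= 2 * l).
      { unfold r, l. apply Rmult_le_reg_r with ((INR n0 + 1) * (INR n0 + 2)); [nra|].
        field_simplify; lra. }
      assert (hb : l < l + w0 * (r - l) < r) by nra.
      exists (l + w0 * (r - l)). split; [lra|]. split.
      { apply Rabs_def1; lra. }
      assert (hh : hc n0 (l + w0 * (r - l)) = w0).
      { unfold hc. fold l r. rewrite ramp_mid; [field|..]; lra. }
      rewrite (scatter_in X e hc al _ n0); [|exact harmonic_cells|]; rewrite hh; auto.
    - exists 0. split; [lra|]. split; [rewrite Rabs_right; lra|].
      rewrite q0. destruct (Req_dec w0 0) as [->|]; auto.
      replace w0 with 1 by lra. auto. }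
  destruct hex as (b & hb & hbd & hbe). rewrite <- hbe.
  apply H; auto; lra.
Qed.

Lemma finprod_e x n : (forall m, (m < n)%nat -> x m = e) -> finprod X op e x n = e.
Proof.
  induction n as [|n IH]; intros H; simpl; auto.
  rewrite IH, H; auto.
Qed.

Lemma finprod_single x n m :
  (m < n)%nat -> (forall k, (k < n)%nat -> k <> m -> x k = e) -> finprod X op e x n = x m.
Proof.
  induction n as [|n IH]; intros hm H; [lia|]. simpl.
  destruct (Nat.eq_dec m n) as [->|ne].
  - rewrite finprod_e; auto. intros k hk. apply H; lia.
  - rewrite IH, (H n), opx1; auto; lia.
Qed.

Lemma finprod_ext x y n :
  (forall m, (m < n)%nat -> x m = y m) -> finprod X op e x n = finprod X op e y n.
Proof. induction n as [|n IH]; intros H; simpl; auto. rewrite IH, H; auto. Qed.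

(** * Moving the loops from one family of cells to another *)

Context (al : nat -> R -> X) (hal : null_sequence X e al).
Context (r s : nat -> R -> R) (hr : cell_family r) (hs : cell_family s).

(** The clock of the [m]-th move. These time intervals are consecutive and exhaust [[0,1)]. *)
Definition stage (m : nat) : R -> R := ramp (1 - / (INR m + 1)) (1 - / (INR m + 2)).

Lemma stage_interval m : 1 - / (INR m + 1) < 1 - / (INR m + 2).
Proof.
  pose proof (pos_INR m).
  assert (/ (INR m + 2) < / (INR m + 1)) by (apply Rinv_lt_contravar; nra). lra.
Qed.

(** The interpolation is between the two cell parameters, which agree at [t = 0] and at [t = 1];
    this keeps the endpoints at [e] throughout. *)
Definition mover (m : nat) (t u : R) : X := al m (r m t + stage m u * (s m t - r m t)).

(** Moved loops are replaced by constants instead of being dropped, so the remaining loops keep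
    their indices and cells. *)
Definition tail (N m : nat) : R -> X := if (m <? N)%nat then (fun _ => e) else al m.

Definition partial_move (N : nat) (t u : R) : X :=
  op (finprod X op e (fun m => mover m t u) N) (scatter e r (tail N) t).

(* By [partial_move_stable] the value does not depend on the chosen [N]. *)
Definition move (t u : R) : X :=
  match excluded_middle_informative (exists N, u <= 1 - / (INR N + 1)) with
  | left H => partial_move (proj1_sig (constructive_indefinite_description _ H)) t u
  | right _ => scatter e s al t
  end.

Lemma tail_lt N m : (m < N)%nat -> tail N m = (fun _ => e).
Proof. intros h. unfold tail. apply Nat.ltb_lt in h. rewrite h. auto. Qed.

Lemma tail_ge N m : (N <= m)%nat -> tail N m = al m.
Proof. intros h. unfold tail. apply Nat.ltb_ge in h. rewrite h. auto. Qed.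

Lemma tail_null N : null_sequence X e (tail N).
Proof.
  destruct hal as [hl hnull]. split.
  - intros n. destruct (Nat.lt_ge_cases n N) as [h|h].
    + rewrite tail_lt by auto. split; auto.
      destruct (shrinking_const X e) as [h' _]. apply (h' 0%nat).
    + rewrite tail_ge by auto. auto.
  - intros U hU HU. destruct (hnull U hU HU) as [N' HN']. exists N'. intros n hn t ht.
    unfold tail. destruct (n <? N)%nat; auto.
Qed.

(** Puts the waiting loops into the form of the last factor in [triple_near_path]. Where none of
    them is active, [e] is represented as [al N 0]. *)
Lemma scatter_tail_value N t :
  exists n w, (N <= n)%nat /\ 0 <= w <= 1 /\ scatter e r (tail N) t = al n w.
Proof.
  assert (hN : al N 0 = e) by apply hal.
  destruct (classic (exists n, 0 < r n t < 1)) as [[n hn]|hno].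
  - rewrite (scatter_in X e r _ t n); auto.
    destruct (Nat.lt_ge_cases n N) as [h|h].
    + exists N, 0. rewrite tail_lt by auto. repeat split; auto; lra.
    + exists n, (r n t). rewrite tail_ge by auto. repeat split; auto; lra.
  - exists N, 0. rewrite scatter_out by eauto. repeat split; auto; lra.
Qed.

(** Cells are disjoint: on the cell of [N] the remaining tail is [e], and off it the factor [al N]
    is [e]. *)
Lemma scatter_tail_split N t :
  scatter e r (tail N) t = op (al N (r N t)) (scatter e r (tail (S N)) t).
Proof.
  destruct (classic (0 < r N t < 1)) as [h|h].
  - rewrite !(scatter_in X e r _ t N), tail_ge, tail_lt, opx1; auto.
  - rewrite (loop_off_cell X e r al N t), op1x; auto; [|apply hal].
    destruct (classic (exists n, 0 < r n t < 1)) as [[n hn]|hno].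
    + rewrite !(scatter_in X e r _ t n); auto.
      assert (n <> N) by (intros ->; auto).
      unfold tail. destruct (Nat.ltb_spec n N), (Nat.ltb_spec n (S N)); auto; lia.
    + rewrite !scatter_out; eauto.
Qed.

(** Up to this time loop [N] has not started to move, so its factor can be absorbed into the tail by
    [scatter_tail_split]. *)
Lemma partial_move_succ N t u :
  u <= 1 - / (INR N + 1) -> partial_move (S N) t u = partial_move N t u.
Proof.
  intros hu. unfold partial_move. simpl. rewrite <- opA. f_equal.
  rewrite (scatter_tail_split N t). f_equal. unfold mover, stage.
  rewrite ramp_left; auto using stage_interval. f_equal. ring.
Qed.

Lemma partial_move_stable N k t u :
  u <= 1 - / (INR N + 1) -> partial_move (N + k) t u = partial_move N t u.
Proof.
  intros hu. induction k as [|k IH]; [rewrite Nat.add_0_r; auto|].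
  rewrite Nat.add_succ_r, partial_move_succ; auto.
  assert (/ (INR (N + k) + 1) <= / (INR N + 1)); [|lra].
  apply inv_INR_le; [lra|]. rewrite plus_INR. pose proof (pos_INR k). lra.
Qed.

Lemma move_partial N t u : u <= 1 - / (INR N + 1) -> move t u = partial_move N t u.
Proof.
  intros hu. unfold move. destruct excluded_middle_informative as [H|H].
  - destruct constructive_indefinite_description as [N' hN']; simpl.
    rewrite <- (partial_move_stable N N'), <- (partial_move_stable N' N), Nat.add_comm; auto.
  - exfalso; eauto.
Qed.

Lemma move_0 t : move t 0 = scatter e r al t.
Proof.
  rewrite (move_partial 0) by (simpl; lra). unfold partial_move. simpl. rewrite op1x. auto.
Qed.

Lemma move_1 t : move t 1 = scatter e s al t.
Proof.
  unfold move. destruct excluded_middle_informative as [[N H]|H]; auto.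
  pose proof (inv_INR_pos N 1 ltac:(lra)). exfalso; lra.
Qed.

Lemma move_ends u : move 0 u = e /\ move 1 u = e.
Proof.
  unfold move. destruct excluded_middle_informative as [H|H].
  - destruct constructive_indefinite_description as [N hN]; simpl. unfold partial_move.
    destruct (scatter_ends X e r (tail N) hr) as [-> ->].
    destruct hr as (_ & _ & er & _), hs as (_ & _ & es & _).
    split; rewrite opx1; apply finprod_e; intros m _; unfold mover;
      destruct (er m) as [r0 r1], (es m) as [s0 s1];
      destruct hal as [hl _]; destruct (hl m) as (_ & l0 & l1).
    + rewrite r0, s0. replace (0 + stage m u * (0 - 0)) with 0 by ring. exact l0.
    + rewrite r1, s1. replace (1 + stage m u * (1 - 1)) with 1 by ring. exact l1.
  - apply scatter_ends; auto.
Qed.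

Lemma mover_cont m : cont01sq X (mover m).
Proof.
  destruct hr as (cr & br & _), hs as (cs & bs & _).
  assert (cv : cont_real (stage m)) by (apply ramp_cont, stage_interval).
  assert (bv : forall u, 0 <= stage m u <= 1) by (intros; apply ramp_bounds).
  destruct hal as [hl _]. destruct (hl m) as (hc & _).
  intros t u ht hu U hU HU.
  destruct (hc _ (segment_bounds _ _ _ (br m t) (bs m t) (bv u)) U hU HU) as (d & hd & H).
  destruct (cr m t ht (d / 3)) as (d1 & hd1 & H1); [lra|].
  destruct (cs m t ht (d / 3)) as (d2 & hd2 & H2); [lra|].
  destruct (cv u hu (d / 3)) as (d3 & hd3 & H3); [lra|].
  exists (Rmin d1 (Rmin d2 d3)). split; [repeat apply Rmin_glb_lt; lra|].
  intros t' u' ht' hu' Ht Hu.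
  apply Rmin_Rgt_l in Ht as [Ht1 Ht2]. apply Rmin_Rgt_l in Ht2 as [Ht2 _].
  apply Rmin_Rgt_l in Hu as [_ Hu]. apply Rmin_Rgt_l in Hu as [_ Hu].
  apply H; auto using segment_bounds.
  specialize (H1 t' ht' Ht1). specialize (H2 t' ht' Ht2). specialize (H3 u' hu' Hu).
  pose proof (br m t). pose proof (bs m t). pose proof (bv u').
  replace (r m t' + stage m u' * (s m t' - r m t') - (r m t + stage m u * (s m t - r m t)))
    (* A convex combination of the changes in [r] and [s], plus the change of stage times a factor
       of absolute value at most 1. *)
    with ((1 - stage m u') * (r m t' - r m t) + stage m u' * (s m t' - s m t)
          + (stage m u' - stage m u) * (s m t - r m t)) by ring.
  apply Rabs_def2 in H1, H2, H3. apply Rabs_def1; nra.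
Qed.

Lemma partial_move_cont N : cont01sq X (partial_move N).
Proof.
  apply sq_product.
  - induction N as [|N IH]; simpl.
    + apply (cont01sq_fst X (fun _ => e)).
      destruct (shrinking_const X e) as [h' _]. apply (h' 0%nat).
    + apply sq_product; auto using mover_cont.
  - apply (cont01sq_fst X (scatter e r (tail N))). apply scatter_cont; auto using tail_null.
Qed.

(** During stage [n] the loops below [n] have settled in their new cells, loop [n] is moving, and
    the waiting loops contribute a single value. *)
Lemma move_late d u t :
  0 < d -> u < 1 -> 1 - d < u -> 0 <= u ->
  exists n w n' w', / (INR n + 2) < d /\ (n <= n')%nat /\ 0 <= w <= 1 /\ 0 <= w' <= 1 /\
    move t u = op (op (finprod X op e (fun m => al m (s m t)) n) (al n w)) (al n' w').
Proof.
  intros hd hu1 hud hu0.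
  destruct (small_inv_INR (1 - u) 2) as [N hN]; try lra.
  assert (hn : exists n, 1 - / (INR n + 1) <= u < 1 - / (INR n + 2)).
  { revert hN. induction N as [|N IH]; intros hN.
    - exists 0%nat. simpl in *. lra.
    - destruct (Rlt_or_le u (1 - / (INR N + 2))) as [h|h]; [apply IH; lra|].
      exists (S N). rewrite S_INR in *.
      replace (INR N + 1 + 1) with (INR N + 2) by ring. lra. }
  destruct hn as [n [hn1 hn2]].
  destruct (scatter_tail_value (S n) t) as (n' & w' & hn' & hw' & Hw').
  exists n, (r n t + stage n u * (s n t - r n t)), n', w'.
  destruct hr as (_ & br & _), hs as (_ & bs & _).
  split; [lra|]. split; [lia|].
  split; [apply segment_bounds; auto; apply ramp_bounds|]. split; auto.
  (* Index [S n] puts the moving loop [n] in as the last factor of the finite product. *)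
  rewrite (move_partial (S n)).
  2: { rewrite S_INR. replace (INR n + 1 + 1) with (INR n + 2) by ring. lra. }
  unfold partial_move. rewrite Hw'. simpl. f_equal. f_equal.
  apply finprod_ext. intros m hm. unfold mover, stage.
  rewrite ramp_right; [f_equal; ring | apply stage_interval |].
  assert (/ (INR n + 1) <= / (INR m + 2)); [|lra].
  apply inv_INR_le; [lra|]. apply le_INR in hm. rewrite S_INR in hm. lra.
Qed.

(** At late times the settled product is [e] or the value of one loop, because the new cells are
    disjoint. The triple lemmas then absorb the moving and the waiting factor. *)
Lemma move_cont_top t0 U :
  0 <= t0 <= 1 -> is_open X U -> U (move t0 1) ->
  exists d, d > 0 /\ forall t u, 0 <= t <= 1 -> 0 <= u < 1 ->
    Rabs (t - t0) < d -> Rabs (u - 1) < d -> U (move t u).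
Proof.
  intros ht0 hU HU. rewrite move_1 in HU.
  pose proof hs as (cs & bs & _ & ds). pose proof hal as [hl _].
  destruct (classic (exists m, 0 < s m t0 < 1)) as [[m hm]|hno].
  - rewrite (scatter_in X e s al t0 m) in HU; auto.
    destruct (triple_near_path al (al m) (s m t0) U) as (d & hd & H); auto; [apply hl|].
    destruct (cs m t0 ht0 (Rmin d (Rmin (s m t0) (1 - s m t0)))) as (d1 & hd1 & H1).
    { repeat apply Rmin_glb_lt; lra. }
    pose proof (inv_INR_pos m 2 ltac:(lra)) as hmp.
    (* The bound [1/(m+2)] forces the current stage [n] to exceed [m], so loop [m] has already
       settled. *)
    assert (hdp : 0 < Rmin d (/ (INR m + 2))) by (apply Rmin_glb_lt; lra).
    exists (Rmin d1 (Rmin d (/ (INR m + 2)))). split.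
    { apply Rmin_glb_lt; lra. }
    intros t u ht hu htd hud.
    apply Rmin_Rgt_l in htd as [htd _]. apply Rmin_Rgt_l in hud as [_ hud].
    specialize (H1 t ht htd).
    apply Rmin_Rgt_l in H1 as [Ha H1]. apply Rmin_Rgt_l in H1 as [Hb Hc].
    apply Rabs_def2 in hud, Hb, Hc.
    destruct (move_late (Rmin d (/ (INR m + 2))) u t) as (n & w & n' & w' & h1 & h2 & h3 & h4 & ->);
      try lra.
    apply Rmin_Rgt_l in h1 as [h1 h1'].
    apply inv_INR_lt_rev in h1'; try lra.
    rewrite (finprod_single _ n m).
    + apply H; auto. apply Rle_lt_trans with (2 := h1).
      apply inv_INR_le; [lra|]. apply le_INR in h2. lra.
    + apply INR_lt. lra.
    + intros k _ hk. apply loop_off_cell; auto. intros hk'. apply hk.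
      apply (ds t); auto. lra.
  - rewrite scatter_out in HU by eauto.
    destruct (triple_near_tail al U) as (d0 & hd0 & H0); auto.
    destruct (small_inv_INR d0 2) as [N hN]; try lra.
    (* Settled loops of index below [N] are near [e] by continuity at [t0]; those from [N] on are
       left to [triple_near_tail]. *)
    destruct (uniform_below (fun m d => forall t n1 w1 n2 w2, 0 <= t <= 1 ->
       0 <= w1 <= 1 -> 0 <= w2 <= 1 ->
       Rabs (t - t0) < d -> / (INR n1 + 2) < d -> / (INR n2 + 2) < d ->
       U (op (op (al m (s m t)) (al n1 w1)) (al n2 w2))) N) as (d1 & hd1 & H1).
    + intros m d d' hdd H; intros. apply H; auto; lra.
    + intros m _.
      destruct (triple_near_path al (al m) (s m t0) U) as (d & hd & H); auto; [apply hl|..].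
      { rewrite (loop_off_cell X e s al); eauto. }
      destruct (cs m t0 ht0 d hd) as (d1 & hd1 & H1).
      exists (Rmin d d1). split; [apply Rmin_glb_lt; lra|].
      intros t n1 w1 n2 w2 ht hw1 hw2 h h1 h2.
      apply Rmin_Rgt_l in h as [_ h]. apply Rmin_Rgt_l in h1 as [h1 _].
      apply Rmin_Rgt_l in h2 as [h2 _]. apply H; auto.
    + assert (hdp : 0 < Rmin d0 d1) by (apply Rmin_glb_lt; lra).
      exists (Rmin d0 d1). split; auto. intros t u ht hu htd hud.
      apply Rmin_Rgt_l in htd as [_ htd]. apply Rabs_def2 in hud.
      destruct (move_late (Rmin d0 d1) u t) as (n & w & n' & w' & h1 & h2 & h3 & h4 & ->);
        try lra.
      apply Rmin_Rgt_l in h1 as [h1 h1'].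
      assert (h2' : / (INR n' + 2) <= / (INR n + 2)).
      { apply inv_INR_le; [lra|]. apply le_INR in h2. lra. }
      destruct (classic (exists m, (m < n)%nat /\ 0 < s m t < 1)) as [(m & hmn & hm)|hno'].
      * rewrite (finprod_single _ n m); auto.
        2: { intros k _ hk. apply loop_off_cell; auto. intros hk'. apply hk.
             apply (ds t); auto. }
        destruct (Nat.lt_ge_cases m N) as [hlt|hge]; [apply H1; auto; lra|].
        apply H0; auto; try lra.
        apply Rle_lt_trans with (2 := hN).
        apply inv_INR_le; [lra|]. apply le_INR in hge. lra.
      * rewrite finprod_e.
        (* No settled loop is active, so [al n 0], which equals [e], supplies the first of the three
           factors. *)
        -- assert (he : al n 0 = e) by apply hl. rewrite <- he.
           apply H0; auto; lra.
        -- intros m hm. apply loop_off_cell; auto. intros h; eauto.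
Qed.

(** Below time 1, [move] is locally a single [partial_move]. At time 1, the earlier times are
    covered by [move_cont_top] and the final slice by [scatter_cont]. *)
Lemma move_cont : cont01sq X move.
Proof.
  intros t0 u0 ht0 hu0 U hU HU.
  destruct (Rlt_or_le u0 1) as [hlt|hge].
  - destruct (small_inv_INR (1 - u0) 1) as [N hN]; try lra.
    rewrite (move_partial N) in HU by lra.
    destruct (partial_move_cont N t0 u0 ht0 hu0 U hU HU) as (d & hd & H).
    exists (Rmin d (1 - / (INR N + 1) - u0)). split; [apply Rmin_glb_lt; lra|].
    intros t u ht hu htd hud.
    apply Rmin_Rgt_l in htd as [htd _]. apply Rmin_Rgt_l in hud as [hud hud'].
    apply Rabs_def2 in hud'. rewrite (move_partial N) by lra. auto.
  - assert (u0 = 1) as -> by lra.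
    destruct (move_cont_top t0 U ht0 hU HU) as (d & hd & H).
    assert (hsc : cont01 X (scatter e s al)) by (apply scatter_cont; auto).
    rewrite move_1 in HU. destruct (hsc t0 ht0 U hU HU) as (d' & hd' & H').
    exists (Rmin d d'). split; [apply Rmin_glb_lt; lra|].
    intros t u ht hu htd hud.
    apply Rmin_Rgt_l in htd as [htd htd']. apply Rmin_Rgt_l in hud as [hud _].
    destruct (Rlt_or_le u 1) as [hlt'|hge'].
    + apply H; auto. lra.
    + replace u with 1 by lra. rewrite move_1. auto.
Qed.

Lemma scatter_homotopic : loop_homotopic X e (scatter e r al) (scatter e s al).
Proof.
  exists move. split; [apply move_cont|]. split; [|split].
  - intros; apply move_0.
  - intros; apply move_1.
  - intros; apply move_ends.
Qed.
End PreDeltaMonoid.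

(** * The Cantor gaps as cells *)

Lemma tern_succ m j : tern (S m) j = (3 * tern m (j / 2) + j mod 2)%nat.
Proof. reflexivity. Qed.

(** All ternary digits are 0 or 1, and the digit string of ones has value [(3^m - 1)/2]. *)
Lemma tern_bound m j : (2 * tern m j + 1 <= 3 ^ m)%nat.
Proof.
  revert j. induction m as [|m IH]; intros j; [simpl; lia|].
  rewrite tern_succ, Nat.pow_succ_r'.
  specialize (IH (j / 2)%nat). pose proof (Nat.mod_upper_bound j 2). lia.
Qed.

Lemma tern_inj m j j' :
  (j < 2 ^ m)%nat -> (j' < 2 ^ m)%nat -> tern m j = tern m j' -> j = j'.
Proof.
  revert j j'. induction m as [|m IH]; intros j j' hj hj' h.
  - simpl in *. lia.
  - rewrite Nat.pow_succ_r' in hj, hj'. change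
      (3 * tern m (j / 2) + j mod 2 = 3 * tern m (j' / 2) + j' mod 2)%nat in h.
    pose proof (Nat.mod_upper_bound j 2). pose proof (Nat.mod_upper_bound j' 2).
    pose proof (Nat.div_mod_eq j 2). pose proof (Nat.div_mod_eq j' 2).
    assert (j / 2 = j' / 2)%nat; [|lia].
    apply IH; try (apply Nat.Div0.div_lt_upper_bound; lia). lia.
Qed.

(** Separates the leading [a] digits, with value [q], from the last [b] digits, with value [rho]. *)
Lemma tern_split a b j :
  exists q rho, tern (a + b) j = (3 ^ b * q + rho)%nat /\ (2 * rho + 1 <= 3 ^ b)%nat.
Proof.
  revert j. induction b as [|b IH]; intros j.
  - exists (tern a j), 0%nat. rewrite Nat.add_0_r. simpl. lia.
  - destruct (IH (j / 2)%nat) as (q & rho & h1 & h2).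
    exists q, (3 * rho + j mod 2)%nat. rewrite Nat.add_succ_r, tern_succ.
    pose proof (Nat.mod_upper_bound j 2). rewrite h1, Nat.pow_succ_r'. lia.
Qed.

(** [level] and [position] invert [piece_index]: [S i] equals [2^(n-1) + k - 1], which lies in
    [[2^(n-1), 2^n)], so its binary logarithm is [n - 1]. *)
Definition level (i : nat) : nat := S (Nat.log2 (S i)).
Definition position (i : nat) : nat := (i + 2 - 2 ^ Nat.log2 (S i))%nat.

Lemma piece_level_position i :
  (1 <= level i)%nat /\ (1 <= position i <= 2 ^ (level i - 1))%nat /\
  piece_index (level i, position i) = i.
Proof.
  unfold level, position, piece_index.
  pose proof (Nat.log2_spec (S i) ltac:(lia)) as h. rewrite Nat.pow_succ_r' in h.
  replace (S (Nat.log2 (S i)) - 1)%nat with (Nat.log2 (S i)) by lia.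
  repeat split; lia.
Qed.

Lemma level_position_piece n k :
  (1 <= n)%nat -> (1 <= k <= 2 ^ (n - 1))%nat ->
  level (piece_index (n, k)) = n /\ position (piece_index (n, k)) = k.
Proof.
  intros hn hk. unfold piece_index, level, position.
  assert (hl : Nat.log2 (S (2 ^ (n - 1) + k - 2)) = (n - 1)%nat).
  { apply Nat.log2_unique; [lia|]. rewrite Nat.pow_succ_r'. lia. }
  rewrite hl. lia.
Qed.

Definition gap_left (i : nat) : R := I_left (level i) (position i).
Definition gap_right (i : nat) : R := gap_left i + / 3 ^ level i.

(** In units of [1/3^n] the left endpoints are at least 6 apart and the gaps have length 1. *)
Lemma gap_order_same_level n T T' :
  (T < T')%nat -> INR (6 * T + 1) / 3 ^ n + / 3 ^ n <= INR (6 * T' + 1) / 3 ^ n.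
Proof.
  intros h. pose proof (Rinv_0_lt_compat (3 ^ n) ltac:(apply pow_lt; lra)).
  assert (h' : (6 * T + 1 + 1 <= 6 * T' + 1)%nat) by lia.
  apply le_INR in h'. rewrite plus_INR in h'. change (INR 1) with 1 in h'. unfold Rdiv. nra.
Qed.

(* A deeper gap lies in an interval [2q/3^n, (2q+1)/3^n], while a gap of level [n]
   starts at an odd multiple of [1/3^n]. *)
Lemma gap_order_diff_level n b T j :
  let l := INR (6 * T + 1) / 3 ^ n in
  let l' := INR (6 * tern (n + b) j + 1) / 3 ^ (S (n + b)) in
  l + / 3 ^ n <= l' \/ l' + / 3 ^ (S (n + b)) <= l.
Proof.
  intros l l'. destruct (tern_split n b j) as (q & rho & h1 & h2).
  assert (hA : 0 < 3 ^ n) by (apply pow_lt; lra).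
  assert (hB : 0 < 3 ^ b) by (apply pow_lt; lra).
  apply le_INR in h2. rewrite pow_INR, plus_INR, mult_INR in h2. simpl INR in h2.
  replace (1 + 1 + 1) with 3 in h2 by ring.
  assert (hl' : l' = (2 * INR q * (3 * 3 ^ b) + 6 * INR rho + 1) / (3 * 3 ^ n * 3 ^ b)).
  { unfold l'. rewrite h1. simpl pow. rewrite pow_add.
    rewrite !plus_INR, !mult_INR, plus_INR, mult_INR, pow_INR. simpl INR.
    replace (1 + 1 + 1) with 3 by ring. field. lra. }
  pose proof (pos_INR rho) as hrho.
  assert (hE : / 3 ^ S (n + b) = / (3 * 3 ^ n * 3 ^ b)).
  { simpl pow. rewrite pow_add. f_equal. ring. }
  (* Comparison over the common denominator [3^(n+b+1)], in both directions. *)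
  assert (hsc : forall a b' c, a * (3 * 3 ^ b) <= b' ->
     c = b' / (3 * 3 ^ n * 3 ^ b) -> a / 3 ^ n <= c).
  { intros a b' c hab ->. apply le_div_iff; [nra|].
    replace (a / 3 ^ n * (3 * 3 ^ n * 3 ^ b)) with (a * (3 * 3 ^ b)) by (field; lra). auto. }
  assert (hsc2 : forall a b' c, b' <= a * (3 * 3 ^ b) ->
     c = b' / (3 * 3 ^ n * 3 ^ b) -> c <= a / 3 ^ n).
  { intros a b' c hab ->. apply div_le_iff; [nra|].
    replace (a / 3 ^ n * (3 * 3 ^ n * 3 ^ b)) with (a * (3 * 3 ^ b)) by (field; lra). auto. }
  destruct (Nat.lt_ge_cases (6 * T + 1) (2 * q)) as [h|h].
  - left. replace (l + / 3 ^ n) with ((INR (6 * T + 1) + 1) / 3 ^ n)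
      by (unfold l; field; lra).
    apply hsc with (2 := hl').
    apply le_INR in h. rewrite S_INR in h. rewrite (mult_INR 2 q) in h. simpl (INR 2) in h. nra.
  - right. unfold l. rewrite hE.
    apply hsc2 with (2 * INR q * (3 * 3 ^ b) + 6 * INR rho + 2).
    + assert (h' : (2 * q + 1 <= 6 * T + 1)%nat) by lia.
      apply le_INR in h'. rewrite (plus_INR (2 * q)), (mult_INR 2 q) in h'.
      simpl (INR 2) in h'. simpl (INR 1) in h'. nra.
    + rewrite hl'. field. lra.
Qed.

Lemma gap_bounds i : 0 <= gap_left i < gap_right i /\ gap_right i <= 1.
Proof.
  unfold gap_right, gap_left, I_left. unfold level. set (n := Nat.log2 (S i)).
  pose proof (tern_bound n (position i - 1)) as h.
  replace (S n - 1)%nat with n by lia. set (T := tern n (position i - 1)) in *.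
  assert (hA : 0 < 3 ^ S n) by (apply pow_lt; lra).
  pose proof (Rinv_0_lt_compat _ hA). pose proof (pos_INR (6 * T + 1)).
  unfold Rdiv. split; [split; nra|].
  assert (h' : (6 * T + 1 + 1 <= 3 ^ S n)%nat) by (rewrite Nat.pow_succ_r'; lia).
  apply le_INR in h'. rewrite pow_INR, (plus_INR (6 * T + 1)) in h'.
  replace (INR 3) with 3 in h' by (simpl; ring). simpl (INR 1) in h'.
  replace (INR (6 * T + 1) * / 3 ^ S n + / 3 ^ S n)
    with ((INR (6 * T + 1) + 1) / 3 ^ S n) by (field; lra).
  apply div_le_iff; lra.
Qed.

Lemma gap_disjoint i j : i <> j -> gap_right i <= gap_left j \/ gap_right j <= gap_left i.
Proof.
  assert (hw : forall i j, (level i < level j)%nat ->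
            gap_right i <= gap_left j \/ gap_right j <= gap_left i).
  { clear. intros i j h. unfold gap_right, gap_left, I_left.
    assert (exists b, level j = S (level i + b)) as [b hb].
    { exists (level j - level i - 1)%nat. lia. }
    rewrite hb. replace (S (level i + b) - 1)%nat with (level i + b)%nat by lia.
    apply gap_order_diff_level. }
  intros hij. destruct (Nat.lt_trichotomy (level i) (level j)) as [h|[h|h]]; auto.
  - unfold gap_right, gap_left, I_left. rewrite h.
    destruct (piece_level_position i) as (_ & hi & ei).
    destruct (piece_level_position j) as (_ & hj & ej).
    rewrite h in hi, ei.
    assert (hne : tern (level j - 1) (position i - 1) <> tern (level j - 1) (position j - 1)).
    { intros ht. apply tern_inj in ht; [|lia|lia]. apply hij.
      replace (position i) with (position j) in ei by lia. congruence. }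
    apply Nat.lt_gt_cases in hne as [hlt|hlt]; [left|right];
      apply gap_order_same_level; auto.
  - destruct (hw j i h); auto.
Qed.

Definition gap_cell (i : nat) : R -> R := ramp (gap_left i) (gap_right i).

Lemma gap_cells : cell_family gap_cell.
Proof. apply (ramp_cells gap_left gap_right); [apply gap_bounds | apply gap_disjoint]. Qed.

(** The two definitions differ in using closed pieces and open cells. At an endpoint of a piece the
    loop has value [x], and disjointness keeps that point out of every other open cell. *)
Lemma tau_product_scatter (X : TopSpace) (x : X) al t :
  (forall n, is_loop X x (al n)) -> tau_product X x al t = scatter x gap_cell al t.
Proof.
  intros hl. unfold tau_product. destruct excluded_middle_informative as [H|H].
  - destruct constructive_indefinite_description as [[n k] hp]; simpl fst; simpl snd.
    cbn [proj1_sig fst snd]. destruct hp as (hn & hk & ht).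
    set (i := piece_index (n, k)).
    destruct (level_position_piece n k hn hk) as [el ep]. fold i in el, ep.
    assert (eL : I_left n k = gap_left i) by (unfold gap_left; rewrite el, ep; auto).
    assert (eR : I_left n k + / 3 ^ n = gap_right i).
    { unfold gap_right. rewrite eL, el. auto. }
    assert (hA : 0 < 3 ^ n) by (apply pow_lt; lra).
    assert (hc : (t - I_left n k) * 3 ^ n = gap_cell i t).
    { pose proof (Rinv_0_lt_compat _ hA). unfold gap_cell.
      rewrite <- eR, <- eL, ramp_mid; [field|..]; lra. }
    change (al i ((t - I_left n k) * 3 ^ n) = scatter x gap_cell al t). rewrite hc.
    destruct (classic (0 < gap_cell i t < 1)) as [h|h].
    + rewrite (scatter_in X x gap_cell al t i); auto using gap_cells.
    + rewrite (loop_off_cell X x gap_cell al i t); auto using gap_cells.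
      rewrite scatter_out; auto. intros j hj.
      assert (hij : i <> j) by (intros ->; auto).
      apply ramp_inner in hj; [|apply gap_bounds]. rewrite eR, eL in ht.
      destruct (gap_disjoint i j hij); lra.
  - rewrite scatter_out; auto. intros i hi. apply H.
    exists (level i, position i). unfold in_piece.
    destruct (piece_level_position i) as (h1 & h2 & _). repeat split; try lia.
    + apply ramp_inner in hi; [|apply gap_bounds]. unfold gap_left in hi. lra.
    + apply ramp_inner in hi; [|apply gap_bounds]. unfold gap_right, gap_left in hi. lra.
Qed.

(** * Permuting the loops, and change of basepoint *)

Lemma cells_reindex r psi :
  cell_family r -> (forall a b, psi a = psi b -> a = b) -> cell_family (fun n : nat => r (psi n)).
Proof. intros (h1 & h2 & h3 & h4) hpsi. repeat split; intros; auto; apply h2 || apply h3 || eauto. Qed.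

(** Permuting the loops over fixed cells amounts to permuting the cells under fixed loops, which is
    the setting of [scatter_homotopic]. *)
Lemma scatter_reindex (X : TopSpace) (x : X) r al (phi psi : nat -> nat) t :
  cell_family r -> (forall a, psi (phi a) = a) -> (forall b, phi (psi b) = b) ->
  scatter x (fun n => r (psi n)) al t = scatter x r (fun n => al (phi n)) t.
Proof.
  intros hr h1 h2.
  destruct (classic (exists n, 0 < r n t < 1)) as [[n hn]|hno].
  - rewrite (scatter_in X x r _ t n), (scatter_in X x (fun n => r (psi n)) _ t (phi n)); auto.
    + rewrite h1. auto.
    + apply cells_reindex; auto. intros a b hab. rewrite <- (h2 a), <- (h2 b), hab. auto.
    + rewrite h1. auto.
  - rewrite !scatter_out; eauto.
Qed.

Lemma loop_homotopic_ext (X : TopSpace) (x : X) a b a' b' :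
  (forall t, a t = a' t) -> (forall t, b t = b' t) ->
  loop_homotopic X x a b -> loop_homotopic X x a' b'.
Proof.
  intros ha hb (H & h1 & h2 & h3 & h4). exists H. repeat split; auto.
  - intros. rewrite <- ha. auto.
  - intros. rewrite <- hb. auto.
  - apply h4; auto.
  - apply h4; auto.
Qed.

Lemma pre_delta_monoid_commutative (X : TopSpace) op e :
  pre_delta_monoid X op e -> transfinitely_pi1_commutative X e.
Proof.
  intros HM al phi hal [hinj hsurj].
  destruct (fun_choice nat (fun b a => phi a = b) hsurj) as [psi hpsi].
  assert (hpsi' : forall a, psi (phi a) = a) by (intros a; apply hinj; auto).
  pose proof hal as [hl _].
  assert (hcells : cell_family (fun n => gap_cell (psi n))).
  { apply cells_reindex; [apply gap_cells|].
    intros a b hab. rewrite <- (hpsi a), <- (hpsi b), hab. auto. }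
  apply loop_homotopic_ext with (3 := scatter_homotopic X op e HM al hal _ _ gap_cells hcells).
  - intros t. symmetry. apply tau_product_scatter. auto.
  - intros t. rewrite (scatter_reindex X e gap_cell al phi psi); auto using gap_cells.
    symmetry. apply (tau_product_scatter X e (fun n => al (phi n))). auto.
Qed.

Lemma pre_delta_group_translate (X : TopSpace) op e x :
  pre_delta_group X op e -> exists op', pre_delta_monoid X op' x.
Proof.
  intros [(hA & h1 & hp) hinv]. destruct (hinv x) as (y & hxy & hyx).
  (* Left multiplication by [y], the inverse of [x], carries this operation to [op] and [x] to [e].
     Its path condition follows from that of [op] used twice, once with the constant path at [y]. *)
  exists (fun a b => op (op a y) b). split; [|split].
  - intros a b c. rewrite !hA. auto.
  - intros a. rewrite hxy. split; [apply h1|]. rewrite <- hA, hyx. apply h1.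
  - intros p q cp cq.
    assert (cy : is_path X (fun _ => y)).
    { intros t ht U hU HU. exists 1. split; auto. lra. }
    exact (hp _ _ (hp _ _ cp cy) cq).
Qed.

Theorem mainTheorem12 :
  forall (X : TopSpace) (op : X -> X -> X) (e : X),
    pre_delta_group X op e -> path_connected X ->
    forall x : X, transfinitely_pi1_commutative X x.
Proof.
  intros X op e HG _ x.
  destruct (pre_delta_group_translate X op e x HG) as [op' HM].
  exact (pre_delta_monoid_commutative X op' x HM).
Qed.
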